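(* Let $(S,\mathcal{S},\nu)$, $(G,\mathcal{G})$, the kernel $c(\eta,d\gamma)$ and the generator $\mathcal{L}$ be as in the context and satisfy (Rev), and let $R$ be a positive measure on $S\times G\times G$ satisfying (A1)–(A5), with density $r$ and core $\mathcal{C}$. Then for all $f \in \mathcal{C}$ $$\nu\left[(\mathcal{L}f)^2\right] - \frac14 \int \left[\nabla_\gamma\nabla_\delta f(\eta)\right]^2 dR = \int \nu(d\eta)\,c(\eta,d\gamma)\,c(\eta,d\delta)\,[1-r(\eta,\gamma,\delta)]\,\nabla_\gamma f(\eta)\,\nabla_\delta f(\eta).$$
   Context: $(S,\mathcal{S},\nu)$ is a probability space; $G$ is a set of measurable transformations from $S$ to $S$, with a $\sigma$-field $\mathcal{G}$ (the maps $(\eta,\gamma)\mapsto\gamma(\eta)$ and, below, $\gamma\mapsto\gamma^{-1}$ are measurable). To each $\eta\in S$ is associated a positive $\sigma$-finite measure $c(\eta,d\gamma)$ on $(G,\mathcal{G})$ such that $\eta\mapsto\int\varphi(\gamma)c(\eta,d\gamma)$ is measurable for every measurable $\varphi:G\to[0,+\infty]$. Put $\nabla_\gamma f := f\circ\gamma-f$ and $\nu_c(d\eta,d\gamma):=\nu(d\eta)c(\eta,d\gamma)$. $\mathcal{L}$ is a Markov generator on $L^2(\nu)$ with dense domain $\mathcal{D}(\mathcal{L})$, given for $f\in\mathcal{D}(\mathcal{L})$ by $\mathcal{L}f(\eta)=\int_G\nabla_\gamma f(\eta)\,c(\eta,d\gamma)$ (absolutely convergent for $\nu$-a.e. $\eta$).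 (Rev) For every $\gamma\in G$ there is a unique $\gamma^{-1}\in G$ such that $\gamma^{-1}(\gamma(\eta))=\eta$ holds $\nu_c$-a.e.; moreover, for every $\Psi\in L^1(\nu_c)$, $\int\Psi(\eta,\gamma)c(\eta,d\gamma)\nu(d\eta)=\int\Psi(\gamma(\eta),\gamma^{-1})c(\eta,d\gamma)\nu(d\eta)$. Conditions on $R$: (A1) There is a core $\mathcal{C}$ of $\mathcal{D}(\mathcal{L})$ such that for each $f\in\mathcal{C}$ the function $(\eta,\gamma,\delta)\mapsto\nabla_\gamma f(\eta)\nabla_\delta f(\eta)$ belongs to $L^1(R)$. (A2) $\gamma(\delta(\eta))=\delta(\gamma(\eta))$ holds $R$-almost everywhere. (A3) $\int F(\eta,\delta,\gamma)\,dR=\int F(\eta,\gamma,\delta)\,dR$ for any $F\in L^1(R)$. (A4) $\int F(\gamma(\eta),\gamma^{-1},\delta)\,dR=\int F(\eta,\gamma,\delta)\,dR$ for any $F\in L^1(R)$. (A5) $R$ is absolutely continuous with respect to $\nu(d\eta)c(\eta,d\gamma)c(\eta,d\delta)$, with density $r(\eta,\gamma,\delta)$. Here $\nabla_\gamma\nabla_\delta f(\eta)=f(\delta(\gamma(\eta)))-f(\gamma(\eta))-f(\delta(\eta))+f(\eta)$. The right-hand side of the claimed identity is understood as the $\nu$-integral in $\eta$ of the inner double integral in $(\gamma,\delta)$ (the latter being absolutely convergent for $\nu$-a.e. $\eta$). *)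

(* Defs.v *)
From HB Require Import structures.
From mathcomp Require Import all_boot all_order all_algebra.
From mathcomp Require Import all_classical all_reals all_analysis measurable_realfun.
Set Implicit Arguments.
Unset Strict Implicit.
Unset Printing Implicit Defensive.
Import Order.TTheory GRing.Theory Num.Theory.
Import numFieldNormedType.Exports.
Local Open Scope classical_set_scope.
Local Open Scope ring_scope.

Section semidirect_product.
Local Open Scope ereal_scope.
Context d1 d2 (T1 : measurableType d1) (T2 : measurableType d2) (R : realType).
Variable m : {measure set T1 -> \bar R}.
Variable k : T1 -> {measure set T2 -> \bar R}.

(* This is what makes m(dx) k(x, dy) a measure on T1 * T2.  For a kernel of
   sigma-finite, but not uniformly s-finite, measures it does not follow from
   the measurability of x |-> k x B. *)
Definition jointly_measurable :=
  forall A : set (T1 * T2), measurable A ->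
    measurable_fun [set: T1] (fun x => k x (xsection A x)).

Hypothesis mk : jointly_measurable.

(* The measure m(dx) k(x, dy); [mk] occurs only so that the measure instance
   below can be inferred. *)
Definition semidirect (_ : jointly_measurable) (A : set (T1 * T2)) : \bar R :=
  \int[m]_x k x (xsection A x).

Let semidirect0 : semidirect mk set0 = 0.
Proof. by rewrite [LHS]integral0_eq// => x _; rewrite xsection0. Qed.

Let semidirect_ge0 A : 0 <= semidirect mk A.
Proof. by apply: integral_ge0. Qed.

Let semidirect_sigma_additive : semi_sigma_additive (semidirect mk).
Proof.
move=> F mF tF mUF.
rewrite [X in _ --> X](_ : _ = \sum_(n <oo) semidirect mk (F n)).
  by apply/cvg_closeP; split; [exact: is_cvg_nneseries|rewrite closeE].
rewrite -integral_nneseries//; last by move=> n; exact: mk.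
apply: eq_integral => x _; apply/esym/cvg_lim => //=; rewrite xsection_bigcup.
apply: (measure_sigma_additive _ (trivIset_xsection tF)) => ?.
exact: measurable_xsection.
Qed.

HB.instance Definition _ := isMeasure.Build _ _ _ (semidirect mk)
  semidirect0 semidirect_ge0 semidirect_sigma_additive.

End semidirect_product.

(* Elements of L^2(nu) are handled through representatives: measurable functions
   with finite norm, equality meaning nu-almost everywhere equality. *)
Section L2.
Context d (S : measurableType d) (R : realType) (nu : probability S R).
Implicit Types (f g : S -> R) (D C : set (S -> R)).

Definition L2 : set (S -> R) := [set f | f \in Lfun nu 2%:E].

Definition L2norm f : \bar R := 'N[nu]_2%:E[EFin \o f].

Definition L2dense D := forall f, L2 f ->
  forall e : R, 0 < e -> exists2 g, D g & (L2norm (f \- g)%R < e%:E)%E.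

(* Strongly continuous semigroup of bounded, positivity preserving linear
   operators on L^2(nu) fixing the constant function 1. *)
Record markov_semigroup (P : R -> (S -> R) -> (S -> R)) : Prop := {
  sg_L2 : forall t f, 0 <= t -> L2 f -> L2 (P t f) ;
  sg_linear : forall t a f g, 0 <= t -> L2 f -> L2 g ->
    {ae nu, forall x, P t (fun y => a * f y + g y) x = a * P t f x + P t g x} ;
  sg_bounded : forall t, 0 <= t ->
    exists M : R, forall f, L2 f -> (L2norm (P t f) <= M%:E * L2norm f)%E ;
  sg_0 : forall f, L2 f -> {ae nu, forall x, P 0 f x = f x} ;
  sg_D : forall s t f, 0 <= s -> 0 <= t -> L2 f ->
    {ae nu, forall x, P (s + t) f x = P s (P t f) x} ;
  sg_continuous : forall f, L2 f ->
    L2norm (P t f \- f) @[t --> (0 : R)^'+] --> 0%E ;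
  sg_positive : forall t f, 0 <= t -> L2 f ->
    {ae nu, forall x, 0 <= f x} -> {ae nu, forall x, 0 <= P t f x} ;
  sg_1 : forall t, 0 <= t -> {ae nu, forall x, P t (cst 1) x = 1}
}.

Definition generator_at (P : R -> (S -> R) -> (S -> R)) f g :=
  [/\ L2 f, L2 g &
   L2norm (fun x => t^-1 * (P t f x - f x) - g x) @[t --> (0 : R)^'+] --> 0%E].

Definition markov_generator D (L : (S -> R) -> (S -> R)) :=
  L2dense D /\
  exists P, [/\ markov_semigroup P,
    forall f, D f <-> exists g, generator_at P f g &
    forall f, D f -> generator_at P f (L f)].

Definition is_core D (L : (S -> R) -> (S -> R)) C :=
  [/\ C `<=` D,
      C (cst 0),
      forall a f g, C f -> C g -> C (fun x => a * f x + g x) &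
      forall f, D f -> forall e : R, 0 < e -> exists2 g, C g &
        (L2norm (f \- g)%R + L2norm (L f \- L g)%R < e%:E)%E].

End L2.

Section jump_dynamics.
Context dS dG (S : measurableType dS) (G : measurableType dG) (R : realType).
Variable act : G -> S -> S.

(* G is a set of transformations of S: [act g] is the map g. *)
Definition transformation_set :=
  injective act /\ measurable_fun [set: S * G] (fun p => act p.2 p.1).

Definition nabla (g : G) (f : S -> R) : S -> R := fun x => f (act g x) - f x.

Variables (nu : probability S R).
Variable c : S -> {sigma_finite_measure set G -> \bar R}.

Definition measurable_family := forall phi : G -> \bar R,
  measurable_fun setT phi -> (forall g, 0 <= phi g)%E ->
  measurable_fun setT (fun x => \int[c x]_g phi g)%E.

Definition one_jump (x : S) : {measure set G -> \bar R} := c x.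

Definition two_jumps (x : S) : {measure set (G * G) -> \bar R} :=
  (c x \x c x)%E.

Definition has_jump_form (D : set (S -> R)) (L : (S -> R) -> (S -> R)) :=
  forall f, D f -> {ae nu, forall x,
    (c x).-integrable setT (fun g => (nabla g f x)%:E) /\
    (L f x)%:E = (\int[c x]_g (nabla g f x)%:E)%E}.

(* g^-1 is only characterised through an identity holding nu_c-a.e., hence the
   map g |-> g^-1 is unique up to nu_c-a.e. equality. *)
Definition is_inverse (nuc : {measure set (S * G) -> \bar R}) (inv : G -> G) :=
  measurable_fun setT inv /\
  {ae nuc, forall p, act (inv p.2) (act p.2 p.1) = p.1}.

Definition Rev (nuc : {measure set (S * G) -> \bar R}) (inv : G -> G) :=
  [/\ is_inverse nuc inv,
      forall inv', is_inverse nuc inv' -> {ae nuc, forall p, inv' p.2 = inv p.2} &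
      forall Psi : S * G -> R, nuc.-integrable setT (EFin \o Psi) ->
        (\int[nuc]_p (Psi p)%:E =
         \int[nuc]_p (Psi (act p.2 p.1, inv p.2))%:E)%E].

(* Triples (x, g, h) are encoded as (x, (g, h)) : S * (G * G). *)
Variable Rm : {measure set (S * (G * G)) -> \bar R}.

Definition A1 (D : set (S -> R)) (L : (S -> R) -> (S -> R)) (C : set (S -> R)) :=
  is_core nu D L C /\
  forall f, C f -> Rm.-integrable setT
    (fun p => (nabla p.2.1 f p.1 * nabla p.2.2 f p.1)%:E).

Definition A2 :=
  {ae Rm, forall p, act p.2.1 (act p.2.2 p.1) = act p.2.2 (act p.2.1 p.1)}.

Definition A3 := forall F : S * (G * G) -> R, Rm.-integrable setT (EFin \o F) ->
  (\int[Rm]_p (F (p.1, (p.2.2, p.2.1)))%:E = \int[Rm]_p (F p)%:E)%E.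

Definition A4 (inv : G -> G) :=
  forall F : S * (G * G) -> R, Rm.-integrable setT (EFin \o F) ->
  (\int[Rm]_p (F (act p.2.1 p.1, (inv p.2.1, p.2.2)))%:E = \int[Rm]_p (F p)%:E)%E.

Definition A5 (nucc : {measure set (S * (G * G)) -> \bar R})
    (r : S * (G * G) -> R) :=
  Rm `<< nucc /\
  [/\ measurable_fun setT r, forall p, 0 <= r p &
      forall A, measurable A -> Rm A = (\int[nucc]_(p in A) (r p)%:E)%E].

End jump_dynamics.

(* Main.v *)
(* Write u = nabla_g f, v = nabla_h f and w = nabla_g nabla_h f on S * G * G.
   Reversing the first jump sends u to -u, w to -w and v to v + w, while
   exchanging the jumps exchanges u and v and fixes w by (A2).  Invariance of R
   under the reversal turns the integral of u v into that of -u (v + w), and that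
   of v w into that of -(v + w) w; with the exchange symmetry this gives
   R[w^2] = -2 R[v w] = -2 R[u w] = 4 R[u v].  Finally R[u v] is the integral of
   r u v against nu(dx) c(x, dg) c(x, dh), and (L f x)^2 is, for almost every x,
   the integral of u v against c(x, dg) c(x, dh). *)

Require Import Defs.
From HB Require Import structures.
From mathcomp Require Import all_boot all_order all_algebra.
From mathcomp Require Import all_classical all_reals all_analysis measurable_realfun.
From mathcomp Require Import ring.
Set Implicit Arguments.
Unset Strict Implicit.
Unset Printing Implicit Defensive.
Import Order.TTheory GRing.Theory Num.Theory.
Import numFieldNormedType.Exports.
Local Open Scope classical_set_scope.
Local Open Scope ring_scope.

(** * Integration against a mixture of measures *)

Section mixture.
Local Open Scope ereal_scope.
Context d d' (X : measurableType d) (Y : measurableType d') (R : realType).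
Variables (m : {measure set X -> \bar R}) (K : X -> {measure set Y -> \bar R}).
Variable M : {measure set Y -> \bar R}.
Hypothesis mK : forall A, measurable A -> measurable_fun [set: X] (K ^~ A).
Hypothesis ME : forall A, measurable A -> M A = \int[m]_x K x A.

Import HBNNSimple.

Let mixture_nnsfun (h : {nnsfun Y >-> R}) :
  \int[M]_y (h y)%:E = \int[m]_x \int[K x]_y (h y)%:E.
Proof.
rewrite integralT_nnsfun sintegralE.
under [RHS]eq_integral do rewrite integralT_nnsfun sintegralE.
rewrite [RHS]ge0_integral_fsum//; last 2 first.
- by move=> r; apply: measurable_funeM; exact: mK.
- by move=> r x _; exact: nnsfun_mulemu_ge0.
apply: eq_fsbigr => r; rewrite inE => -[y _ <-].
rewrite ME// ge0_integralZl//; first exact: mK.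
by rewrite lee_fin.
Qed.

(** By linearity the formula holds for simple functions; it passes to [h] by monotone convergence,
    under [M] on the left, under each [K x] and then under [m] on the right. No finiteness of the
    measures enters, only measurability in [x] of the mass of each set. *)
Lemma ge0_integral_mixture (h : Y -> \bar R) :
  measurable_fun setT h -> (forall y, 0 <= h y) ->
  \int[M]_y h y = \int[m]_x \int[K x]_y h y.
Proof.
move=> mh h0; pose g := nnsfun_approx measurableT mh.
have mg n : measurable_fun setT (EFin \o g n) by exact/measurable_EFinP.
have nd_g y : {homo (fun n => (g n y)%:E) : n k / (n <= k)%O >-> n <= k}.
  by move=> *; rewrite lee_fin; exact/lefP/nd_nnsfun_approx.
have limg y : limn (fun n => (g n y)%:E) = h y.
  by apply/cvg_lim => //; exact: cvg_nnsfun_approx.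
have limE (mu : {measure set Y -> \bar R}) :
    \int[mu]_y h y = limn (fun n => \int[mu]_y (g n y)%:E).
  rewrite -monotone_convergence//.
    by apply: eq_integral => y _; rewrite limg.
  by move=> n y _; rewrite lee_fin.
rewrite limE; under [RHS]eq_integral do rewrite limE.
rewrite [RHS]monotone_convergence//.
- by congr (limn _); apply/funext => n; exact: mixture_nnsfun.
- move=> n; apply: measurable_fun_integral_kernel => //;
    [by move=> y; rewrite lee_fin|exact: mg].
- by move=> n x _; apply: integral_ge0 => y _; rewrite lee_fin.
- move=> x _ a b ab; apply: ge0_le_integral => //.
  + by move=> y _; rewrite lee_fin.
  + exact: mg.
  + exact: mg.
  + by move=> y _; exact: nd_g.
Qed.

Lemma measurable_integral_mixture (h : Y -> \bar R) :
  measurable_fun setT h -> measurable_fun setT (fun x => \int[K x]_y h y).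
Proof.
move=> mh; under eq_fun do rewrite integralE.
by apply: emeasurable_funB; apply: measurable_fun_integral_kernel => //;
  [exact: measurable_funepos|exact: measurable_funeneg].
Qed.

Variable h : Y -> \bar R.
Hypothesis ih : M.-integrable setT h.

Let mh : measurable_fun setT h. Proof. exact: measurable_int ih. Qed.

Let integrable_mixture_ge0 (g : Y -> \bar R) : (forall y, 0 <= g y) ->
  M.-integrable setT g -> m.-integrable setT (fun x => \int[K x]_y g y).
Proof.
move=> g0 ig; have mg := measurable_int _ ig; apply/integrableP; split.
  exact: measurable_integral_mixture.
under eq_integral do rewrite gee0_abs ?integral_ge0//.
by rewrite -ge0_integral_mixture//; exact: integrable_lty.
Qed.

Lemma integrable_mixture : m.-integrable setT (fun x => \int[K x]_y h y).
Proof.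
under eq_fun do rewrite integralE.
apply: integrableB => //; apply: integrable_mixture_ge0 => //;
  [exact: integrable_funepos|exact: integrable_funeneg].
Qed.

(** The integral of [|h|] against [K x] is itself [m]-integrable in [x], hence finite for almost
    every [x]. *)
Lemma ae_integrable_mixture : {ae m, forall x, (K x).-integrable setT h}.
Proof.
have /integrable_ae : m.-integrable setT (fun x => \int[K x]_y `|h y|).
  by apply: integrable_mixture_ge0 => //; exact: integrable_abse.
move=> /(_ measurableT); apply: filterS => x /(_ I) fin.
by apply/integrableP; split => //; move/fin_numPlt : fin => /andP[].
Qed.

(** On an [m]-null set of [x] both parts of [h] may have infinite integral, and the inner integral
    is then a conventional value. Integrated over [x] both parts are finite, so the nonnegative
    formulas can be subtracted. *)
Lemma integral_mixture : \int[M]_y h y = \int[m]_x \int[K x]_y h y.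
Proof.
under [RHS]eq_integral do rewrite integralE.
rewrite integralB//; last 2 first.
- by apply: integrable_mixture_ge0 => //; exact: integrable_funepos.
- by apply: integrable_mixture_ge0 => //; exact: integrable_funeneg.
rewrite integralE -!ge0_integral_mixture//.
- exact: measurable_funeneg.
- exact: measurable_funepos.
Qed.

End mixture.

(** * Fubini for the measure m(dx) k(x, dy) *)

Section semidirect_integral.
Local Open Scope ereal_scope.
Context d1 d2 (T1 : measurableType d1) (T2 : measurableType d2) (R : realType).
Variables (m : {measure set T1 -> \bar R}).
Variables (k : T1 -> {measure set T2 -> \bar R}) (mk : jointly_measurable k).

Let mpair x : measurable_fun setT (pair x : T2 -> T1 * T2).
Proof. exact: pair1_measurable. Qed.

(* The measure delta_x(dz) k(x, dy); the pushforward instance is given by name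
   because inference cannot find the proof of measurability it takes. *)
Let slice (x : T1) : {measure set (T1 * T2) -> \bar R} :=
  measure_function_pushforward__canonical__measure_function_Measure
    (k x) (mpair x).

Let sliceE x A : slice x A = k x (xsection A x).
Proof. by rewrite /slice/= /pushforward/= xsectionE. Qed.

Let mslice A : measurable A -> measurable_fun setT (slice ^~ A).
Proof. by move=> mA; under eq_fun do rewrite sliceE; exact: mk. Qed.

Let integral_slice x (h : T1 * T2 -> \bar R) : measurable_fun setT h ->
  \int[slice x]_p h p = \int[k x]_y h (x, y).
Proof.
move=> mh; rewrite [LHS]integralE [RHS]integralE; congr (_ - _).
- rewrite [LHS]ge0_integral_pushforward//.
  + by rewrite preimage_setT; apply: eq_integral => y _; rewrite /= !funeposE.
  + exact: measurable_funepos.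
- rewrite [LHS]ge0_integral_pushforward//.
  + by rewrite preimage_setT; apply: eq_integral => y _; rewrite /= !funenegE.
  + exact: measurable_funeneg.
Qed.

Lemma measurable_integral_semidirect (h : T1 * T2 -> \bar R) :
  measurable_fun setT h -> measurable_fun setT (fun x => \int[k x]_y h (x, y)).
Proof.
move=> mh; under eq_fun do rewrite -integral_slice//.
exact: measurable_integral_mixture.
Qed.

Variable h : T1 * T2 -> \bar R.
Hypothesis ih : (semidirect m mk).-integrable setT h.

Let mh : measurable_fun setT h. Proof. exact: measurable_int ih. Qed.

(** Exhibits [semidirect] as the mixture of its slices, so that the results on mixtures apply;
    [integral_slice] then turns integrals over a slice into integrals over [k x]. *)
Let semidirectE A : measurable A -> semidirect m mk A = \int[m]_x slice x A.
Proof. by move=> mA; under [RHS]eq_integral do rewrite sliceE. Qed.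

Lemma ae_integrable_semidirect :
  {ae m, forall x, (k x).-integrable setT (fun y => h (x, y))}.
Proof.
have := ae_integrable_mixture mslice semidirectE ih.
apply: filterS => x /integrableP[_ fin]; apply/integrableP; split.
  exact: measurable_fun_pair2.
by move: fin; rewrite (@integral_slice x (abse \o h))//; exact: measurableT_comp.
Qed.

Lemma integrable_semidirect : m.-integrable setT (fun x => \int[k x]_y h (x, y)).
Proof.
under eq_fun do rewrite -integral_slice//.
exact: (integrable_mixture mslice semidirectE).
Qed.

Lemma integral_semidirect :
  \int[semidirect m mk]_p h p = \int[m]_x \int[k x]_y h (x, y).
Proof.
under [RHS]eq_integral do rewrite -integral_slice//.
exact: (integral_mixture mslice semidirectE).
Qed.

End semidirect_integral.

(** * Integration against a measure with a density *)

Section density.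
Local Open Scope ereal_scope.
Context d (T : measurableType d) (R : realType).
Variables (m M : {measure set T -> \bar R}) (r : T -> R).
Hypothesis mr : measurable_fun setT r.
Hypothesis r0 : forall x, (0 <= r x)%R.
Hypothesis ME : forall A, measurable A -> M A = \int[m]_(x in A) (r x)%:E.

(** A measure with density [r] is the mixture over [m] of the point masses r(x) delta_x, which makes
    the density formula another instance of mixtures. *)
Let mass (x : T) : {measure set T -> \bar R} :=
  [the {measure set T -> \bar R} of mscale (NngNum (r0 x)) (dirac x)].

Let massE x A : mass x A = (r x)%:E * (\1_A x)%:E.
Proof. by []. Qed.

Let mmass A : measurable A -> measurable_fun setT (mass ^~ A).
Proof.
move=> mA; under eq_fun do rewrite massE.
apply: emeasurable_funM; first exact/measurable_EFinP.
exact/measurable_EFinP.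
Qed.

Let integral_mass x (h : T -> \bar R) : measurable_fun setT h ->
  \int[mass x]_y h y = (r x)%:E * h x.
Proof.
move=> mh; rewrite integralE !ge0_integral_mscale//;
  [|exact: measurable_funeneg|exact: measurable_funepos].
rewrite !integral_dirac//;
  [|exact: measurable_funeneg|exact: measurable_funepos].
rewrite !diracT !mul1e -muleBr//; last exact: add_def_funeposneg.
by rewrite [in RHS](funeposneg h).
Qed.

Let mixtureE A : measurable A -> M A = \int[m]_x mass x A.
Proof.
move=> mA; rewrite ME// integral_mkcond; apply: eq_integral => x _.
by rewrite massE patchE indicE; case: ifPn; rewrite ?mule1 ?mule0.
Qed.

Variable h : T -> \bar R.
Hypothesis ih : M.-integrable setT h.

Let mh : measurable_fun setT h. Proof. exact: measurable_int ih. Qed.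

Lemma integrable_density : m.-integrable setT (fun x => (r x)%:E * h x).
Proof.
under eq_fun do rewrite -integral_mass//.
exact: (integrable_mixture mmass mixtureE).
Qed.

Lemma integral_density : \int[M]_x h x = \int[m]_x ((r x)%:E * h x).
Proof.
under [RHS]eq_integral do rewrite -integral_mass//.
exact: (integral_mixture mmass mixtureE).
Qed.

End density.

(** * Finite integrals and their invariance under maps *)

Lemma integrable_ae_eq d (T : measurableType d) (R : realType)
    (mu : {measure set T -> \bar R}) (f g : T -> \bar R) :
  measurable_fun setT g -> {ae mu, forall x, f x = g x} ->
  mu.-integrable setT f -> mu.-integrable setT g.
Proof.
move=> mg fg /integrableP[mf foo]; apply/integrableP; split => //.
rewrite (ae_eq_integral (abse \o f))//; try exact: measurableT_comp.
by apply: filterS fg => x /= ->.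
Qed.

Section has_integral.
Context d (T : measurableType d) (R : realType) (mu : {measure set T -> \bar R}).
Implicit Types (X Y : T -> R) (a b k l : R).

(** Taking the value as a real number [a] carries integrability along and leaves the arithmetic of
    integrals to [ring], away from extended reals. *)
Definition has_integral X a :=
  mu.-integrable setT (EFin \o X) /\ (\int[mu]_x (X x)%:E = a%:E)%E.

Lemma integrable_has_integral X : mu.-integrable setT (EFin \o X) ->
  has_integral X (fine (\int[mu]_x (X x)%:E)%E).
Proof. by move=> iX; split => //; rewrite fineK//; exact: integrable_fin_num. Qed.

Lemma has_integral_lin k l X Y a b : has_integral X a -> has_integral Y b ->
  has_integral (fun x => k * X x + l * Y x) (k * a + l * b).
Proof.
move=> [iX eX] [iY eY].
have ikX := integrableZl measurableT k iX.
have ilY := integrableZl measurableT l iY.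
split; first exact: (integrableD measurableT ikX ilY).
by rewrite (integralD measurableT ikX ilY) !integralZl// eX eY.
Qed.

Lemma has_integral_ae X Y a : measurable_fun setT Y ->
  {ae mu, forall x, X x = Y x} -> has_integral X a -> has_integral Y a.
Proof.
move=> mY XY [iX eX]; have mEY : measurable_fun setT (EFin \o Y).
  exact/measurable_EFinP.
have XYE : {ae mu, forall x, (X x)%:E = (Y x)%:E} by apply: filterS XY => x ->.
split; first exact: integrable_ae_eq mEY XYE iX.
rewrite -eX; apply: ae_eq_integral => //; first exact: measurable_int iX.
by apply: filterS XYE => x ->.
Qed.

Definition integral_invariant (t : T -> T) := forall F : T -> R,
  mu.-integrable setT (EFin \o F) ->
  (\int[mu]_x (F (t x))%:E = \int[mu]_x (F x)%:E)%E.

(** Invariance only equates integrals; applied to [|X|] it also gives integrability of the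
    composite. *)
Lemma has_integral_comp (t : T -> T) X a :
  measurable_fun setT t -> integral_invariant t ->
  has_integral X a -> has_integral (X \o t) a.
Proof.
move=> mt it [iX eX]; split; last by rewrite it.
apply/integrableP; split.
  exact: (measurableT_comp (measurable_int _ iX) mt).
rewrite (it (fun x => `|X x|)); last exact: (integrable_abse iX).
by have /integrableP[] := iX.
Qed.

(** Here [s] is the exchange of the jumps and [t] the reversal of the first one. Only u v is assumed
    integrable: integrability of u w, v w and w^2 is produced along the way, by composition and
    linear combination. *)
Lemma bochner_identity (s t : T -> T) (u v w : T -> R) a :
  measurable_fun setT s -> measurable_fun setT t ->
  measurable_fun setT u -> measurable_fun setT v -> measurable_fun setT w ->
  integral_invariant s -> integral_invariant t ->
  (forall p, u (s p) = v p) -> {ae mu, forall p, w (s p) = w p} ->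
  {ae mu, forall p, u (t p) = - u p} -> (forall p, v (t p) = v p + w p) ->
  {ae mu, forall p, w (t p) = - w p} ->
  has_integral (fun p => u p * v p) a ->
  has_integral (fun p => w p ^+ 2) (4 * a).
Proof.
move=> ms mt mU mv mw iS it us ws ut vt wt uv.
have uvt : has_integral (fun p => - u p * (v p + w p)) a.
  apply: has_integral_ae (has_integral_comp mt it uv).
    apply: measurable_funM; first exact: measurableT_comp.
    exact: measurable_funD.
  by apply: filterS ut => p /= ->; rewrite vt.
have uw : has_integral (fun p => u p * w p) (- (2 * a)).
  (* u w = u (v + w) - u v, with integral -a - a. *)
  have := has_integral_lin (-1) (-1) uvt uv.
  by congr has_integral; [apply/funext => p|]; ring.
have vw : has_integral (fun p => v p * w p) (- (2 * a)).
  apply: has_integral_ae (has_integral_comp ms iS uw).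
    exact: measurable_funM.
  by apply: filterS ws => p /= ->; rewrite us.
have vwt : has_integral (fun p => (v p + w p) * - w p) (- (2 * a)).
  apply: has_integral_ae (has_integral_comp mt it vw).
    apply: measurable_funM; last exact: measurableT_comp.
    exact: measurable_funD.
  by apply: filterS wt => p /= ->; rewrite vt.
(* w^2 = (v + w) w - v w, with integral 2a + 2a. *)
have := has_integral_lin (-1) (-1) vwt vw.
by congr has_integral; [apply/funext => p|]; ring.
Qed.

End has_integral.

(** * Product integrals and null sets for pairs of jumps *)

Lemma has_integral_prod d1 d2 (T1 : measurableType d1) (T2 : measurableType d2)
    (R : realType) (m1 : {sigma_finite_measure set T1 -> \bar R})
    (m2 : {sigma_finite_measure set T2 -> \bar R}) (X : T1 -> R) (Y : T2 -> R) a b :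
  has_integral m1 X a -> has_integral m2 Y b ->
  has_integral (m1 \x m2)%E (fun p => X p.1 * Y p.2) (a * b).
Proof.
move=> [iX eX] [iY eY].
have mXY : measurable_fun setT (fun p : T1 * T2 => (X p.1 * Y p.2)%:E).
  apply/measurable_EFinP; apply: measurable_funM.
    apply: measurableT_comp => //; apply/measurable_EFinP.
    exact: measurable_int iX.
  apply: measurableT_comp => //; apply/measurable_EFinP.
  exact: measurable_int iY.
have iXY : (m1 \x m2)%E.-integrable setT (fun p => (X p.1 * Y p.2)%:E).
  (* By Tonelli, integrability amounts to finiteness of the iterated integral of |X Y|, which
     factors into two finite integrals. *)
  apply/(integrable12ltyP _ _ mXY).
  have iaX := integrable_abse iX; have iaY := integrable_abse iY.
  rewrite (_ : (\int[m1]_x _)%E =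
      ((\int[m2]_y `|(Y y)%:E|) * \int[m1]_x `|(X x)%:E|)%E).
    rewrite lte_mul_pinfty//; first exact: integral_ge0.
      exact: integrable_fin_num iaY.
    exact: integrable_lty iaX.
  rewrite -ge0_integralZl//; [|exact: measurable_int iaX|exact: integral_ge0].
  apply: eq_integral => x _; under eq_integral do rewrite /= normrM EFinM.
  rewrite ge0_integralZl//; [exact: muleC|exact: measurable_int iaY].
split => //.
rewrite -(integral12_prod_meas1 iXY)/= /fubini_F/=.
under eq_integral do
  (under eq_integral do rewrite EFinM; rewrite integralZl// eY muleC).
by rewrite integralZl// eX muleC.
Qed.

(** The section at x of the lifted null set is A_x * G, of mass c(x, A_x) c(x, G). The first factor
    vanishes for almost every x, and then so does the product even when c(x, G) is infinite, since 0
    * oo = 0. *)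
Lemma ae_semidirect_two_jumps dS dG (S : measurableType dS) (G : measurableType dG)
    (R : realType) (m : {measure set S -> \bar R})
    (c : S -> {sigma_finite_measure set G -> \bar R})
    (mc : jointly_measurable (one_jump c)) (mcc : jointly_measurable (two_jumps c))
    (P : S * G -> Prop) :
  {ae semidirect m mc, forall p, P p} ->
  {ae semidirect m mcc, forall p, P (p.1, p.2.1)}.
Proof.
move=> [A [mA A0 PA]].
pose q (p : S * (G * G)) := (p.1, p.2.1).
have mq : measurable_fun setT q.
  apply: measurable_fun_pair => //.
  exact: measurableT_comp.
have mB : measurable (q @^-1` A) by rewrite -[X in measurable X]setTI; exact: mq.
exists (q @^-1` A); split => //; last by move=> p /= nP; exact: PA.
have cA0 : ae_eq m setT (fun x => one_jump c x (xsection A x)) (cst 0%E).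
  apply/(ae_eq_integral_abs _ measurableT); first exact: (mc _ mA).
  by rewrite -[RHS]A0; apply: eq_integral => x _; rewrite gee0_abs.
transitivity (\int[m]_x (cst 0 x : \bar R))%E; last by rewrite integral0.
apply: ae_eq_integral => //; first exact: (mcc _ mB).
apply: filterS cA0 => x /(_ Logic.I) cA0 _.
have -> : xsection (q @^-1` A) x = xsection A x `*` setT.
  by apply/seteqP; split => -[g h]; rewrite /xsection/= !inE//; case.
rewrite [LHS]product_measure1E//; last exact: measurable_xsection.
by rewrite [X in (X * _)%E]cA0 mul0e.
Qed.

Lemma measurable_nabla dS dG d (S : measurableType dS) (G : measurableType dG)
    (T : measurableType d) (R : realType) (act : G -> S -> S) (f : S -> R)
    (g : T -> G) (x : T -> S) :
  transformation_set act -> measurable_fun setT f ->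
  measurable_fun setT g -> measurable_fun setT x ->
  measurable_fun setT (fun p => nabla act (g p) f (x p)).
Proof.
move=> [_ mact] mf mg mx; apply: measurable_funB; last exact: measurableT_comp.
apply: measurableT_comp => //.
exact: (measurableT_comp mact (measurable_fun_pair mx mg)).
Qed.

(** The inverse relation is known only almost everywhere for one jump. It lifts to two jumps, then
    passes to [Rm] by absolute continuity, and the abstract identity applies. *)
Lemma has_integral_nabla2 dS dG (S : measurableType dS) (G : measurableType dG)
    (R : realType) (nu : probability S R) (act : G -> S -> S)
    (c : S -> {sigma_finite_measure set G -> \bar R})
    (mc : jointly_measurable (one_jump c))
    (mcc : jointly_measurable (two_jumps c))
    (inv : G -> G) (Rm : {measure set (S * (G * G)) -> \bar R}) (f : S -> R) a :
  transformation_set act -> is_inverse act (semidirect nu mc) inv ->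
  Rm `<< semidirect nu mcc -> A2 act Rm -> A3 Rm -> A4 act Rm inv ->
  measurable_fun setT f ->
  has_integral Rm (fun p => nabla act p.2.1 f p.1 * nabla act p.2.2 f p.1) a ->
  has_integral Rm
    (fun p => nabla act p.2.1 (nabla act p.2.2 f) p.1 ^+ 2) (4 * a).
Proof.
move=> Hact [minv invP] Rmcc HA2 HA3 HA4 mf uv; have [_ mact] := Hact.
pose mx : measurable_fun setT (fun p : S * (G * G) => p.1) := measurable_fst.
have mg : measurable_fun setT (fun p : S * (G * G) => p.2.1).
  exact: measurableT_comp.
have mh : measurable_fun setT (fun p : S * (G * G) => p.2.2).
  exact: measurableT_comp.
have mgx : measurable_fun setT (fun p : S * (G * G) => act p.2.1 p.1).
  exact: (measurableT_comp mact (measurable_fun_pair mx mg)).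
have mw : measurable_fun setT
    (fun p : S * (G * G) => nabla act p.2.1 (nabla act p.2.2 f) p.1).
  by apply: measurable_funB; exact: measurable_nabla.
have invR : {ae Rm, forall p, act (inv p.2.1) (act p.2.1 p.1) = p.1}.
  have [B [mB B0 PB]] := ae_semidirect_two_jumps mcc invP.
  have nB : (semidirect nu mcc).-null_set B by exact/(measure0_null_setP _ mB).
  by exists B; split => //; exact: (Rmcc B nB B mB).
apply: (bochner_identity (s := fun p => (p.1, (p.2.2, p.2.1)))
  (t := fun p => (act p.2.1 p.1, (inv p.2.1, p.2.2)))
  (v := fun p => nabla act p.2.2 f p.1) _ _ _ _ _ _ _ _ _ _ _ _ uv) => //.
- by apply: measurable_fun_pair => //; exact: measurable_fun_pair.
- apply: measurable_fun_pair => //; apply: measurable_fun_pair => //.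
  exact: measurableT_comp.
- exact: measurable_nabla.
- exact: measurable_nabla.
(* Symmetry of the second difference is where commutation of the two jumps enters. *)
- by apply: filterS HA2 => p /= e; rewrite /nabla e; ring.
- by apply: filterS invR => p /= e; rewrite /nabla e; ring.
- by move=> p; rewrite /nabla/=; ring.
- by apply: filterS invR => p /= e; rewrite /nabla e; ring.
Qed.

(** * The identity for the generator *)

Theorem corollary2p2 (R : realType) (dS dG : measure_display)
    (S : measurableType dS) (G : measurableType dG)
    (nu : probability S R) (act : G -> S -> S)
    (Hact : transformation_set act)
    (c : S -> {sigma_finite_measure set G -> \bar R})
    (Hc : measurable_family c)
    (mc : jointly_measurable (one_jump c))
    (mcc : jointly_measurable (two_jumps c))
    (D : set (S -> R)) (L : (S -> R) -> (S -> R))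
    (HL : markov_generator nu D L) (HLc : has_jump_form act nu c D L)
    (inv : G -> G) (HRev : Rev act (semidirect nu mc) inv)
    (Rm : {measure set (S * (G * G)) -> \bar R})
    (C : set (S -> R)) (r : S * (G * G) -> R)
    (HA1 : A1 act nu Rm D L C) (HA2 : A2 act Rm) (HA3 : A3 Rm)
    (HA4 : A4 act Rm inv) (HA5 : A5 Rm (semidirect nu mcc) r) :
  forall f, C f ->
  let inner := fun (x : S) (gh : G * G) =>
    ((1 - r (x, gh)) * nabla act gh.1 f x * nabla act gh.2 f x)%:E in
  [/\ {ae nu, forall x, (two_jumps c x).-integrable setT (inner x)},
      nu.-integrable setT (fun x => \int[two_jumps c x]_gh inner x gh)%E &
      (\int[nu]_x ((L f x) ^+ 2)%:E
         - (4^-1)%:E *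
           \int[Rm]_p ((nabla act p.2.1 (nabla act p.2.2 f) p.1) ^+ 2)%:E
       = \int[nu]_x \int[two_jumps c x]_gh inner x gh)%E].
Proof.
move=> f Cf inner.
have [[CD _ _ _] /(_ _ Cf) iuv] := HA1.
have Df : D f by exact: CD.
have [_ [P [_ _ /(_ _ Df)[L2f L2Lf _]]]] := HL.
have mf : measurable_fun setT f.
  by have /sub_Lfun_mfun := L2f; rewrite inE.
have [invP _ _] := HRev; have [Rmcc [mr r0 rE]] := HA5.
have uv := integrable_has_integral iuv; set a := fine _ in uv.
have [_ w2] := has_integral_nabla2 Hact invP Rmcc HA2 HA3 HA4 mf uv.
(* The factor 1/4 cancels the 4 of [w2]; what is subtracted is now [a], the integral of u v against
   [Rm]. *)
rewrite w2 -EFinM mulKf ?pnatr_eq0//.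
pose h (p : S * (G * G)) := nabla act p.2.1 f p.1 * nabla act p.2.2 f p.1.
have irh : (semidirect nu mcc).-integrable setT (fun p => (r p)%:E * (h p)%:E)%E.
  exact (integrable_density mr r0 rE iuv).
have rhE : (\int[semidirect nu mcc]_p ((r p)%:E * (h p)%:E) = a%:E)%E.
  by rewrite -(integral_density mr r0 rE iuv); have [] := uv.
pose I x := (\int[two_jumps c x]_gh ((r (x, gh))%:E * (h (x, gh))%:E))%E.
have iI : nu.-integrable setT I := integrable_semidirect irh.
have IE : (\int[nu]_x I x = a%:E)%E by rewrite -(integral_semidirect irh).
have iL2 := Lfun2_integrable_sqr L2Lf.
(* For almost every x both u v and r u v are integrable against c(x, dg) c(x, dh), the first by
   Fubini with integral (L f x)^2, so the integral of their difference splits. *)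
have innerE : {ae nu, forall x,
    (two_jumps c x).-integrable setT (inner x) /\
    ((L f x ^+ 2)%:E - I x = \int[two_jumps c x]_gh inner x gh)%E}.
  have := ae_integrable_semidirect irh; apply: filterS2 (HLc _ Df).
  move=> x [iLf LfE] irhx.
  have hL : has_integral (c x) (fun g => nabla act g f x) (L f x) by split.
  have [ihx hE] := has_integral_prod hL hL.
  have dE gh : inner x gh = ((nabla act gh.1 f x * nabla act gh.2 f x)%:E -
      (r (x, gh))%:E * (h (x, gh))%:E)%E.
    by rewrite -EFinM -EFinB /inner /h/=; congr EFin; ring.
  have -> : inner x = ((fun gh => (nabla act gh.1 f x * nabla act gh.2 f x)%:E) \-
      (fun gh => (r (x, gh))%:E * (h (x, gh))%:E))%E.
    exact/funext.
  by split; [exact: integrableB|rewrite integralB// hE expr2].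
(* As [nu] need not be complete, [innerE] does not transfer measurability to the right-hand side; it
   is obtained directly from joint measurability of the integrand. *)
have mJ : measurable_fun setT (fun x => \int[two_jumps c x]_gh inner x gh)%E.
  suff minner : measurable_fun setT (fun p : S * (G * G) => inner p.1 p.2).
    exact: (measurable_integral_semidirect mcc minner).
  apply/measurable_EFinP; apply: measurable_funM.
    apply: measurable_funM.
      apply: measurable_funB => //; apply: (measurableT_comp mr).
      exact: measurable_fun_pair.
    by apply: measurable_nabla => //; exact: measurableT_comp.
  by apply: measurable_nabla => //; exact: measurableT_comp.
have iLI := integrableB measurableT iL2 iI.
split.
- by apply: filterS innerE => x [].
- by apply: integrable_ae_eq mJ _ iLI; apply: filterS innerE => x [].
- rewrite -IE -integralB//; apply: ae_eq_integral => //.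
    exact: measurable_int iLI.
  by apply: filterS innerE => x [].
Qed.
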